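(* Let $KG$ be the group algebra of an infinite group $G$ over a field $K$ of characteristic $p\ge0$, and let $f$ be a polynomial in the free algebra $K\langle X\rangle$ such that $f$ is almost a polynomial identity for $KG$. If either $p=0$, or $p>0$ and $f$ is linear in at least one indeterminate, then $f$ is an actual polynomial identity for $KG$ (so that $\mathcal S_{KG}(f)=\mathcal A_{KG}(f)=\mathcal I_{KG}(f)=0$ are finite-dimensional).
   Context: $K\langle X\rangle$ is the free associative $K$-algebra on $X=\{x_1,x_2,\ldots\}$; polynomials are taken with zero constant term. For an associative $K$-algebra $A$ and $f=f(x_1,\ldots,x_n)\in K\langle X\rangle$, let $\mathcal S_A(f)$, $\mathcal A_A(f)$ and $\mathcal I_A(f)$ be, respectively, the $K$-subspace, the $K$-subalgebra and the two-sided ideal of $A$ generated by the set of $f$-values $\{f(a_1,\ldots,a_n): a_1,\ldots,a_n\in A\}$. $f$ is a polynomial identity (PI) for $A$ if $f(a_1,\ldots,a_n)=0$ for all $a_1,\ldots,a_n\in A$; $f$ is almost a polynomial identity for $A$ if $\mathcal S_A(f)$ is finite-dimensional. $f$ is linear in an indeterminate $x_i$ if $x_i$ has degree exactly one in every monomial of $f$. *)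

(* Defs.v *)
From HB Require Import structures.
From mathcomp Require Import all_boot all_algebra.
From mathcomp Require Import finmap.
From mathcomp Require Import boolp classical_sets cardinality.
From mathcomp Require Import monalg.

Set Implicit Arguments.
Unset Strict Implicit.
Unset Printing Implicit Defensive.

Import GRing.Theory.

Local Open Scope classical_set_scope.
Local Open Scope ring_scope.

(* monalg makes {malg R[M]} a ring only for a monomType M, where x * y = 1     *)
(* forces x = y = 1, which excludes groups. The convolution product is         *)
(* therefore installed here on an alias of the R-module {malg R[G]}.           *)
Definition group_algebra (R : comNzRingType) (G : groupType) : Type :=
  {malg R[G]}.

Section GroupAlgebra.
Context (R : comNzRingType) (G : groupType).
Local Notation RG := (group_algebra R G).
Implicit Types (u v w : RG) (c : R) (g : G).

HB.instance Definition _ := GRing.Lmodule.copy RG {malg R[G]}.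

Definition ga_one : RG := << 1%g >>.

Definition ga_mul u v : RG :=
  \sum_(g <- msupp u) \sum_(h <- msupp v) << u@_g * v@_h *g (g * h)%g >>.

Lemma ga_mulEw (d1 d2 : {fset G}) u v :
  (msupp u `<=` d1)%fset -> (msupp v `<=` d2)%fset ->
  ga_mul u v = \sum_(g <- d1) \sum_(h <- d2) << u@_g * v@_h *g (g * h)%g >>.
Proof.
move=> le1 le2; rewrite /ga_mul (big_fset_incl _ le1) /=.
  apply/eq_bigr=> g _; apply/big_fset_incl => // h _ /mcoeff_outdom ->.
  by rewrite mulr0 monalgU0.
move=> g _ /mcoeff_outdom u0.
by rewrite big1 // => h _; rewrite u0 mul0r monalgU0.
Qed.

Lemma ga_mul0r : left_zero 0 ga_mul.
Proof. by move=> u; rewrite /ga_mul msupp0 big_seq_fset0. Qed.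

Lemma ga_mulr0 : right_zero 0 ga_mul.
Proof. by move=> u; rewrite /ga_mul msupp0 big1 // => g _; rewrite big_seq_fset0. Qed.

Lemma ga_mulUl c g v :
  ga_mul << c *g g >> v = \sum_(h <- msupp v) << c * v@_h *g (g * h)%g >>.
Proof.
rewrite (ga_mulEw msuppU_le (fsubset_refl _)) big_seq_fset1.
by apply/eq_bigr => h _; rewrite mcoeffUU.
Qed.

Lemma ga_mulUr c h u :
  ga_mul u << c *g h >> = \sum_(g <- msupp u) << u@_g * c *g (g * h)%g >>.
Proof.
rewrite (ga_mulEw (fsubset_refl _) msuppU_le).
by apply/eq_bigr => g _; rewrite big_seq_fset1 mcoeffUU.
Qed.

Lemma ga_mulUU c1 c2 g1 g2 :
  ga_mul << c1 *g g1 >> << c2 *g g2 >> = << c1 * c2 *g (g1 * g2)%g >>.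
Proof. by rewrite (ga_mulEw msuppU_le msuppU_le) !big_seq_fset1 !mcoeffUU. Qed.

Lemma ga_mulEl u v :
  ga_mul u v = \sum_(g <- msupp u) ga_mul << u@_g *g g >> v.
Proof. by apply/eq_bigr=> g _; rewrite ga_mulUl. Qed.

Lemma ga_mulEr u v :
  ga_mul u v = \sum_(h <- msupp v) ga_mul u << v@_h *g h >>.
Proof.
by rewrite [LHS]/ga_mul exchange_big; apply/eq_bigr=> h _; rewrite ga_mulUr.
Qed.

Lemma ga_mul1r : left_id ga_one ga_mul.
Proof.
move=> u; rewrite /ga_one ga_mulUl [RHS]monalgE.
by apply/eq_bigr=> g _; rewrite mul1r mul1g.
Qed.

Lemma ga_mulr1 : right_id ga_one ga_mul.
Proof.
move=> u; rewrite /ga_one ga_mulUr [RHS]monalgE.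
by apply/eq_bigr=> g _; rewrite mulr1 mulg1.
Qed.

Lemma ga_mulDl : left_distributive ga_mul +%R.
Proof.
move=> u v w; set d := (msupp u `|` msupp v)%fset.
have d_refl := fsubset_refl (msupp w).
rewrite (ga_mulEw (msuppD_le u v : (_ `<=` d)%fset) d_refl).
rewrite (ga_mulEw (fsubsetUl _ _ : (_ `<=` d)%fset) d_refl).
rewrite (ga_mulEw (fsubsetUr _ _ : (_ `<=` d)%fset) d_refl).
rewrite -big_split /=; apply/eq_bigr=> g _.
rewrite -big_split /=; apply/eq_bigr=> h _.
by rewrite mcoeffD mulrDl monalgUD.
Qed.

Lemma ga_mulDr : right_distributive ga_mul +%R.
Proof.
move=> w u v; set d := (msupp u `|` msupp v)%fset.
have d_refl := fsubset_refl (msupp w).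
rewrite (ga_mulEw d_refl (msuppD_le u v : (_ `<=` d)%fset)).
rewrite (ga_mulEw d_refl (fsubsetUl _ _ : (_ `<=` d)%fset)).
rewrite (ga_mulEw d_refl (fsubsetUr _ _ : (_ `<=` d)%fset)).
rewrite -big_split /=; apply/eq_bigr=> g _.
rewrite -big_split /=; apply/eq_bigr=> h _.
by rewrite mcoeffD mulrDr monalgUD.
Qed.

Lemma ga_mulA : associative ga_mul.
Proof.
move=> u v w.
rewrite [RHS](big_morph (ga_mul^~ _) (fun _ _ => ga_mulDl _ _ _) (ga_mul0r _)).
rewrite ga_mulEl; apply/eq_bigr=> g1 _.
rewrite [LHS](big_morph (ga_mul _) (fun _ _ => ga_mulDr _ _ _) (ga_mulr0 _)).
rewrite [RHS](big_morph (ga_mul^~ _) (fun _ _ => ga_mulDl _ _ _) (ga_mul0r _)).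
apply/eq_bigr=> g2 _.
rewrite [LHS](big_morph (ga_mul _) (fun _ _ => ga_mulDr _ _ _) (ga_mulr0 _)).
by rewrite ga_mulEr; apply/eq_bigr=> g3 _; rewrite !ga_mulUU mulrA mulgA.
Qed.

Lemma ga_one_neq0 : ga_one != 0.
Proof.
by apply/eqP => /malgP/(_ 1%g) /eqP; rewrite mcoeffUU mcoeff0 oner_eq0.
Qed.

HB.instance Definition _ := GRing.Zmodule_isNzRing.Build RG
  ga_mulA ga_mul1r ga_mulr1 ga_mulDl ga_mulDr ga_one_neq0.

Lemma ga_scaleE c u : c *: u = ga_mul << c *g 1%g >> u.
Proof. by rewrite ga_mulUl; apply/eq_bigr=> g _; rewrite mul1g. Qed.

Lemma ga_scaleE' c u : c *: u = ga_mul u << c *g 1%g >>.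
Proof.
by rewrite ga_mulUr; apply/eq_bigr=> g _; rewrite mulg1 mulrC.
Qed.

Lemma ga_scalerAl c u v : c *: (u * v) = (c *: u) * v.
Proof. by rewrite ga_scaleE [c *: u]ga_scaleE; apply: ga_mulA. Qed.

Lemma ga_scalerAr c u v : c *: (u * v) = u * (c *: v).
Proof. by rewrite ga_scaleE' [c *: v]ga_scaleE'; apply/esym/ga_mulA. Qed.

HB.instance Definition _ := GRing.Lmodule_isLalgebra.Build R RG ga_scalerAl.
HB.instance Definition _ := GRing.Lalgebra_isAlgebra.Build R RG ga_scalerAr.

End GroupAlgebra.

(* K<X> is the algebra of the free monoid on X; the indeterminate x_(i+1) is   *)
(* the one-letter word of index i.                                             *)
Notation free_algebra K := {malg K[{fmonom nat}]}.

Definition linear_in (K : fieldType) (f : free_algebra K) (i : nat) : Prop :=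
  forall m : {fmonom nat}, m \in msupp f -> count_mem i m = 1%N.

Definition has_char (R : nzRingType) (p : nat) : Prop :=
  if p == 0%N then [pchar R] =i pred0 else p \in [pchar R].

Section GeneratedSubsets.
Context (K : fieldType).

(* Subalgebras are not required to contain 1.                                  *)
Definition is_subspace (V : lmodType K) (S : set V) : Prop :=
  submod_closed [in S].
Definition is_subalgebra (A : algType K) (S : set A) : Prop :=
  is_subspace S /\ (forall u v, S u -> S v -> S (u * v)).
Definition is_ideal (A : algType K) (S : set A) : Prop :=
  is_subspace S /\ (forall a u, S u -> S (a * u) /\ S (u * a)).

Definition finite_dim (V : lmodType K) (S : set V) : Prop :=
  exists e : seq V, S = smallest (@is_subspace V) [set` e].

End GeneratedSubsets.

Section Values.
Context (K : fieldType) (A : algType K).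
Implicit Types (f : free_algebra K) (a : nat -> A).

(* The substitution is total on X; only the finitely many indeterminates       *)
(* occurring in f matter.                                                      *)
Definition feval f a : A :=
  mmap (in_alg A) (fun m : {fmonom nat} => \prod_(i <- m) a i) f.

Definition fvalues f : set A := range (feval f).

Definition value_space f : set A := smallest (@is_subspace K A) (fvalues f).
Definition value_subalgebra f : set A :=
  smallest (@is_subalgebra K A) (fvalues f).
Definition value_ideal f : set A := smallest (@is_ideal K A) (fvalues f).

Definition is_PI f : Prop := forall a, feval f a = 0.
Definition almost_PI f : Prop := finite_dim (value_space f).

End Values.

Arguments fvalues {K} A f.
Arguments value_space {K} A f.
Arguments value_subalgebra {K} A f.
Arguments value_ideal {K} A f.
Arguments is_PI {K} A f.
Arguments almost_PI {K} A f.

(* Main.v *)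
(* The supports of the values of [f] lie in a fixed finite set [T]. Let
   [phi x = sum u_j x v_j] be a map of [KG] with values supported in [T].
   Expanding in group elements, [phi g = sum c h g k]. By P. M. Neumann's
   separation lemma for the conjugation action there is [g] such that no [h g k]
   lies in [T] and [h g k = h' g k'] only if [h k = h' k']; then [phi g = 0]
   forces [phi 1 = 0], and applying this to [x |-> phi (x y)] gives [phi = 0].
   If [f] is linear in [x_i], this applies to [f] as a function of [x_i]. In
   characteristic 0 it applies to the coefficient of [t] in [f (a + t a x)];
   at [x = 1] this makes [t |-> f (t a)] a polynomial with zero derivative,
   hence constant, equal to the constant term 0 of [f]. *)

Require Import Defs.
From HB Require Import structures.
From mathcomp Require Import all_boot all_algebra.
From mathcomp Require Import finmap.
From mathcomp Require Import boolp classical_sets cardinality.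
From mathcomp Require Import monalg.

Set Implicit Arguments.
Unset Strict Implicit.
Unset Printing Implicit Defensive.

Import GRing.Theory.

Local Open Scope classical_set_scope.
Local Open Scope ring_scope.

(** * Separation by a group action *)

Section Separation.
Context (G : groupType) (T : eqType) (act : G -> T -> T).
Hypothesis actM : forall g h x, act (g * h)%g x = act g (act h x).
Hypothesis act1 : forall x, act 1%g x = x.

Definition infinite_orbit (Z : G -> Prop) (x : T) :=
  forall B : seq T, exists2 g, Z g & act g x \notin B.

Definition subgroup_pred (Z : G -> Prop) :=
  Z 1%g /\ (forall g h, Z g -> Z h -> Z (g^-1 * h)%g).

Lemma transporter (Z : G -> Prop) (x : T) : exists c : T -> G,
  forall y, (exists2 g, Z g & act g x = y) -> Z (c y) /\ act (c y) x = y.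
Proof.
have [y|c cP] := @choice T G
  (fun y g => (exists2 g, Z g & act g x = y) -> Z g /\ act g x = y).
  have [[g Zg gx]|nex] := pselect (exists2 g, Z g & act g x = y).
    by exists g.
  by exists 1%g.
by exists c.
Qed.

(* P. M. Neumann's lemma. If [a] has an infinite orbit, some [g0 a] avoids [B];
   the finitely many possible bad values [g a \in B] are then corrected by a
   left factor moving them to [g0 a]. *)
Lemma separation (Z : G -> Prop) (A B : seq T) : subgroup_pred Z ->
  (forall a, a \in A -> infinite_orbit Z a) ->
  exists2 g, Z g & forall a, a \in A -> act g a \notin B.
Proof.
move=> [Z1 ZV]; elim: A B => [|a A IH] B Ainf; first by exists 1%g.
have ZM g h : Z g -> Z h -> Z (g * h)%g.
  move=> Zg Zh; rewrite -[g]invgK; apply: (ZV) => //.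
  by rewrite -[(g^-1)%g]mulg1; apply: ZV.
have [g0 Zg0 g0a] := Ainf a (mem_head _ _) B.
have [c cP] := transporter Z a.
(* If [act g a] falls in [B], then [g] is corrected on the left; the points added are the preimages
   of [B] under the factors [g0 * (c x)^-1]. *)
pose B' := B ++ [seq act (c x * g0^-1)%g y | x <- B, y <- B].
have [|g Zg gA] := IH B'; first by move=> b bA; apply: Ainf; rewrite inE bA orbT.
have [gaB|gaB] := boolP (act g a \in B); last first.
  exists g => // b; rewrite inE => /predU1P[->//|/gA].
  by rewrite mem_cat => /norP[].
have [|Zc ca] := cP (act g a); first by exists g.
exists (g0 * ((c (act g a))^-1 * g))%g; first by apply: ZM => //; apply: ZV.
move=> b; rewrite inE => /predU1P[->|/gA].
  by rewrite !actM -[X in act _^-1%g X]ca -[act _^-1%g _]actM mulVg act1.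
rewrite mem_cat => /norP[_]; apply: contra => bB.
apply/allpairsP; exists (act g a, act (g0 * ((c (act g a))^-1 * g))%g b).
by split=> //=; rewrite -actM !mulgA mulgVK mulgV mul1g.
Qed.

(* Passing to the stabiliser of a point with a finite orbit costs only finite
   index, hence keeps the orbit of [o] infinite. *)
Lemma fix_or_separate (Z : G -> Prop) (o : T) (A B : seq T) :
  subgroup_pred Z -> infinite_orbit Z o ->
  exists g, [/\ Z g, act g o \notin B &
    forall a, a \in A -> act g a = a \/ act g a \notin B].
Proof.
have [n] := ubnP (size A); elim: n => // n IH in Z A *; rewrite ltnS => leAn.
move=> Zsub oinf; have [Z1 ZV] := Zsub.
have [Ainf|] := pselect (forall a, a \in A -> infinite_orbit Z a).
  have [|g Zg gA] := @separation Z (o :: A) B Zsub.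
    by move=> a; rewrite inE => /predU1P[->//|/Ainf].
  exists g; split=> //; first exact/gA/mem_head.
  by move=> a aA; right; apply: gA; rewrite inE aA orbT.
move=> /existsNP[a /not_implyP[aA /existsNP[F0 aF0]]].
(* Recursing into the stabiliser of [a] fixes [a], so [a] can leave the list. *)
have [|||g [[Zg ga] go gA]] := IH (fun g => Z g /\ act g a = a) (rem a A).
- by rewrite size_rem // (leq_trans _ leAn) // ltn_predL; case: A aA {leAn}.
- split=> [|g h [Zg ga] [Zh ha]]; first by rewrite act1.
  split; first exact: ZV.
  by rewrite actM ha -[X in act _^-1%g X]ga -actM mulVg act1.
- move=> F; have [c cP] := transporter Z a.
  (* [g] moves [o] out of the translates of [F] by the [c x], so [g] corrected to stabilise [a]
     still moves [o] out of [F]. *)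
  have [g Zg gF] := oinf [seq act (c x) y | x <- F0, y <- F].
  have gaF0 : act g a \in F0.
    by apply: contrapT => /negP ngaF0; apply: aF0; exists g.
  have [|Zc ca] := cP (act g a); first by exists g.
  exists ((c (act g a))^-1 * g)%g.
    split; first exact: ZV.
    by rewrite actM -[X in act _^-1%g X]ca -actM mulVg act1.
  apply: contra gF => goF; apply/allpairsP.
  by exists (act g a, act ((c (act g a))^-1 * g)%g o); rewrite /= -actM mulVKg.
- exists g; split=> // b bA; have [->|neba] := eqVneq b a; first by left.
  by apply: gA; move: bA; rewrite (perm_mem (perm_to_rem aA)) inE (negPf neba).
Qed.

End Separation.

(* The first copy of [G] carries conjugation, for which [h g k = h' g k'] reads
   [g . (k' k^-1) = h'^-1 h]; the second carries left translation, whose orbit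
   of 1 is infinite and which lets [g] avoid any finite set. *)
Definition conj_or_translate (G : groupType) (g : G) (x : G + G) : G + G :=
  match x with inl w => inl (g * w * g^-1)%g | inr y => inr (g * y)%g end.

Lemma generic_element (G : groupType) (s : seq (G * G)) (T : seq G) :
  infinite_set [set: G] ->
  exists g : G,
    (forall t, t \in s -> (t.1 * g * t.2)%g \notin T) /\
    (forall t t', t \in s -> t' \in s ->
      (t.1 * g * t.2 = t'.1 * g * t'.2)%g -> (t.1 * t.2 = t'.1 * t'.2)%g).
Proof.
move=> Ginf; pose act := @conj_or_translate G.
have actM g h x : act (g * h)%g x = act g (act h x).
  by case: x => y /=; rewrite ?invgM !mulgA.
have act1 x : act 1%g x = x by case: x => y /=; rewrite ?invg1 ?mulg1 mul1g.
pose A : seq (G + G) := [seq inl (t'.2 * t.2^-1)%g | t' <- s, t <- s].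
pose B : seq (G + G) := [seq inl (t'.1^-1 * t.1)%g | t' <- s, t <- s]
  ++ [seq inr (t.1^-1 * y * t.2^-1)%g | t <- s, y <- T].
have [//||g [_ go gA]] := @fix_or_separate _ _ _ actM act1 (fun=> True)
  (inr 1%g) A B.
  move=> F; apply: contrapT => nex; apply: Ginf.
  pose pr (x : G + G) : G := if x is inr y then y else 1%g.
  apply: (@sub_finite_set _ _ [set` map pr F]); last exact: finite_seq.
  move=> g _ /=; apply: contrapT => /negP gF; apply: nex; exists g => //.
  apply: contra gF => gF; apply/mapP; exists (inr (g * 1)%g) => //=.
  by rewrite mulg1.
exists g; split=> [t ts|t t' ts t's e].
  apply: contra go => tT; rewrite mem_cat; apply/orP; right; apply/allpairsP.
  exists (t, (t.1 * g * t.2)%g); split=> //=.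
  by rewrite !mulgA mulVg mul1g mulgK mulg1.
have gw : act g (inl (t'.2 * t.2^-1)%g) = inl (t'.1^-1 * t.1)%g.
  congr inl; apply: (mulgI t'.1); rewrite !mulgA -e mulgV mul1g.
  by rewrite mulgK mulgK.
have wA : inl (t'.2 * t.2^-1)%g \in A by apply/allpairsP; exists (t', t).
(* The image lies in [B], so only the fixed case survives: [t'.1^-1 * t.1 = t'.2 * t.2^-1]. *)
have [|] := gA _ wA; rewrite gw.
  move=> [] /(congr1 (fun x => t'.1 * x * t.2)%g).
  by rewrite !mulgA mulgV mul1g mulgVK.
by rewrite mem_cat => /norP[/negP[]]; apply/allpairsP; exists (t', t).
Qed.

(** * Sums of two-sided multiplications *)

Section GeneralizedLinear.
Context (R : comNzRingType) (A : algType R).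
Implicit Types phi psi : A -> A.

(** Stronger than linearity: over a group algebra, the finite list leaves only finitely many
    products [h g k] to separate. *)
Definition generalized_linear phi :=
  exists s : seq (A * A), forall x, phi x = \sum_(t <- s) t.1 * x * t.2.

Lemma generalized_linear_mul u v : generalized_linear (fun x => u * x * v).
Proof. by exists [:: (u, v)] => x; rewrite big_seq1. Qed.

Lemma generalized_linear0 : generalized_linear (fun=> 0).
Proof. by exists [::] => x; rewrite big_nil. Qed.

Lemma generalized_linearD phi psi : generalized_linear phi ->
  generalized_linear psi -> generalized_linear (fun x => phi x + psi x).
Proof.
by move=> [s sP] [s' s'P]; exists (s ++ s') => x; rewrite big_cat sP s'P.
Qed.

Lemma generalized_linear_sum (I : eqType) (r : seq I) (F : I -> A -> A) :
  (forall i, i \in r -> generalized_linear (F i)) ->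
  generalized_linear (fun x => \sum_(i <- r) F i x).
Proof.
elim: r => [_|i r IH Fr].
  by under eq_fun do rewrite big_nil; exact: generalized_linear0.
under eq_fun do rewrite big_cons; apply: generalized_linearD.
  exact/Fr/mem_head.
by apply: IH => j jr; apply: Fr; rewrite inE jr orbT.
Qed.

Lemma generalized_linear_mull u phi :
  generalized_linear phi -> generalized_linear (fun x => u * phi x).
Proof.
move=> [s sP]; exists [seq (u * t.1, t.2) | t <- s] => x.
by rewrite big_map sP mulr_sumr; apply: eq_bigr => t _; rewrite !mulrA.
Qed.

Lemma generalized_linearZ (c : R) phi :
  generalized_linear phi -> generalized_linear (fun x => c *: phi x).
Proof.
move=> /(generalized_linear_mull c%:A) [s sP]; exists s => x.
by rewrite -sP mulr_algl.
Qed.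

Lemma generalized_linear_comp_mulr y phi :
  generalized_linear phi -> generalized_linear (fun x => phi (x * y)).
Proof.
move=> [s sP]; exists [seq (t.1, y * t.2) | t <- s] => x.
by rewrite big_map sP; apply: eq_bigr => t _; rewrite !mulrA.
Qed.

End GeneralizedLinear.

Lemma mulr_sum_sandwich (R : pzRingType) (I J : Type) (r : seq I) (q : seq J)
    (u : I -> R) (v : J -> R) (x : R) :
  (\sum_(i <- r) u i) * x * (\sum_(j <- q) v j) =
  \sum_(i <- r) \sum_(j <- q) u i * x * v j.
Proof.
by rewrite !mulr_suml; apply: eq_bigr => i _; rewrite mulr_sumr.
Qed.

(** * Vanishing of maps of [KG] with bounded support *)

Section GroupAlgebraVanishing.
Context (K : fieldType) (G : groupType).
Hypothesis Ginf : infinite_set [set: G].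
Local Notation KG := (group_algebra K G).

Definition supported_in (T : seq G) (u : KG) :=
  forall z, z \notin T -> u@_z = 0.

Lemma ga_coefD (u v : KG) z : (u + v)@_z = u@_z + v@_z.
Proof. exact: mcoeffD. Qed.

Lemma ga_coefZ (c : K) (u : KG) z : (c *: u)@_z = c * u@_z.
Proof. exact: mcoeffZ. Qed.

Lemma ga_coef_sum (I : Type) (r : seq I) (P : pred I) (F : I -> KG) z :
  (\sum_(i <- r | P i) F i)@_z = \sum_(i <- r | P i) (F i)@_z.
Proof.
apply: (big_morph (fun u : KG => u@_z)) => [u v|]; first exact: ga_coefD.
exact: mcoeff0.
Qed.

Lemma group_mulU (c d : K) (g h : G) :
  (<< c *g g >> : KG) * << d *g h >> = << c * d *g (g * h)%g >>.
Proof. exact: ga_mulUU. Qed.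

(* Evaluate at a generic group element [g]: the products [h g k] then avoid [T]
   and coincide only when the products [h k] do, so that the vanishing of the
   value at [g] entails that of the value at [1]. *)
Lemma sum_translates_eq0 (s : seq (K * (G * G))) (T : seq G) :
  (forall g, supported_in T
     (\sum_(t <- s) << t.1 *g (t.2.1 * g * t.2.2)%g >>)) ->
  (\sum_(t <- s) << t.1 *g (t.2.1 * t.2.2)%g >> : KG) = 0.
Proof.
move=> sT; have [g [gT ginj]] := generic_element [seq t.2 | t <- s] T Ginf.
pose pi (t : K * (G * G)) := (t.2.1 * g * t.2.2)%g.
(* For [y] in [T] the sum is empty; otherwise it is the coefficient at [y] of the value at [g]. *)
have zero y : \sum_(t <- s | pi t == y) t.1 = 0.
  have [yT|yT] := boolP (y \in T).
    rewrite big_seq_cond big1 // => t /andP[ts /eqP ty].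
    by case/negP: (gT _ (map_f snd ts)); rewrite -/(pi t) ty.
  have := sT g y yT; rewrite ga_coef_sum => e; rewrite -[RHS]e big_mkcond.
  by apply: eq_bigr => t _; rewrite mcoeffU -/(pi t); case: eqP.
(* Group by [pi]: within a class the products [t.2.1 * t.2.2] agree, so [zero] kills its sum. *)
transitivity (\sum_(y <- undup (map pi s)) \sum_(t <- s | pi t == y)
    << t.1 *g (t.2.1 * t.2.2)%g >> : KG).
  rewrite (exchange_big_dep xpredT) //= big_seq [RHS]big_seq.
  apply: eq_bigr => t ts; rewrite -big_filter.
  have -> : [seq y <- undup (map pi s) | pi t == y] = [:: pi t].
    rewrite (eq_filter (a2 := pred1 (pi t))) => [|y]; last exact: eq_sym.
    by rewrite filter_pred1_uniq ?undup_uniq // mem_undup map_f.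
  by rewrite big_seq1.
apply: big1_seq => y /andP[_]; rewrite mem_undup => /mapP[t ts ->].
rewrite -big_filter big_seq.
rewrite (eq_bigr (fun t' => << t'.1 *g (t.2.1 * t.2.2)%g >>)) => [|t'].
  rewrite -big_seq big_filter; set k := (t.2.1 * t.2.2)%g.
  have morphU : {morph (fun c : K => << c *g k >> : KG) : c d / c + d}.
    exact: monalgUD.
  by rewrite -(big_morph _ morphU (monalgU0 _)) zero monalgU0.
rewrite mem_filter => /andP[/eqP e t's]; congr << _ *g _ >>.
by apply: (ginj t'.2 t.2) e; exact: map_f.
Qed.

Lemma generalized_linear_eq0 (phi : KG -> KG) (T : seq G) :
  generalized_linear phi -> (forall x, supported_in T (phi x)) ->
  forall x, phi x = 0.
Proof.
(* Only the value at [1] is controlled, so [y] is absorbed into [x |-> phi (x * y)], whose values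
   are still supported in [T]. *)
move=> phil phiT y; rewrite -[y]mul1r.
have [s sP] := generalized_linear_comp_mulr y phil; rewrite sP.
have decomp g : \sum_(t <- s) t.1 * (<< g >> : KG) * t.2 =
    \sum_(t <- [seq (t.1@_hk.1 * t.2@_hk.2, hk) | t <- s,
       hk <- [seq (h, k) | h <- msupp t.1, k <- msupp t.2]])
     << t.1 *g (t.2.1 * g * t.2.2)%g >> :> KG.
  rewrite big_allpairs_dep; apply: eq_bigr => t _.
  rewrite big_allpairs_dep /=.
  transitivity ((\sum_(h <- msupp t.1) << t.1@_h *g h >> : KG) * << g >>
    * (\sum_(k <- msupp t.2) << t.2@_k *g k >> : KG)).
    by congr (_ * _ * _); exact: monalgE.
  rewrite mulr_sum_sandwich; apply: eq_bigr => h _; apply: eq_bigr => k _.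
  by rewrite !group_mulU mulr1.
have := decomp 1%g; rewrite -[(<< 1%g >> : KG)]/(1 : KG) => ->.
rewrite (eq_bigr (fun t => << t.1 *g (t.2.1 * t.2.2)%g >> : KG)) => [|t _].
  by apply: (@sum_translates_eq0 _ T) => g; rewrite -decomp -sP; exact: phiT.
by rewrite mulg1.
Qed.

End GroupAlgebraVanishing.

(** * Directional and radial derivatives of [f] *)

Section SubstitutionPolynomials.
Context (K : fieldType) (A : algType K).
Implicit Types (a b : nat -> A) (m : seq nat) (f : free_algebra K).

Lemma fevalE f a : feval f a = \sum_(m <- msupp f) f@_m *: \prod_(i <- m) a i.
Proof. by rewrite /feval mmapE; apply: eq_bigr => m _; rewrite mulr_algl. Qed.

(** Scalars are central, which makes evaluation at them multiplicative over a noncommutative [A]. *)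
Lemma alg_comm_poly (q : {poly A}) (t : K) : comm_poly q t%:A.
Proof. by rewrite /comm_poly mulr_algl mulr_algr. Qed.

Definition line_word a b m : {poly A} :=
  \prod_(i <- m) ((a i)%:P + (b i)%:P * 'X).

(** This is [f] on the line [a + b 'X]; its coefficient of degree 1 is the derivative at [a] along
    [b]. *)
Definition line_poly f a b : {poly A} :=
  \sum_(m <- msupp f) (f@_m)%:A%:P * line_word a b m.

Lemma line_polyE f a b (t : K) :
  (line_poly f a b).[t%:A] = feval f (fun i => a i + t *: b i).
Proof.
rewrite fevalE /line_poly horner_sum; apply: eq_bigr => m _.
rewrite hornerCM mulr_algl; congr (_ *: _); rewrite /line_word.
elim: {f} (m : seq nat) => [|i s IH]; first by rewrite !big_nil hornerC.
rewrite !big_cons hornerM_comm ?IH; last exact: alg_comm_poly.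
by rewrite hornerD hornerC hornerCM hornerX mulr_algr.
Qed.

Lemma coef0_line_word a b m : (line_word a b m)`_0 = \prod_(i <- m) a i.
Proof.
rewrite /line_word; elim: m => [|i m IH]; first by rewrite !big_nil coefC.
rewrite !big_cons mulrDl -mulrA coefD !coefCM -commr_polyX coefMX.
by rewrite mulr0 addr0 IH.
Qed.

Lemma coef1_line_word a b i m :
  (line_word a b (i :: m))`_1 =
  a i * (line_word a b m)`_1 + b i * \prod_(j <- m) a j.
Proof.
rewrite {1}/line_word big_cons mulrDl -mulrA coefD !coefCM -commr_polyX coefMX.
by rewrite -/(line_word a b m) /= coef0_line_word.
Qed.

Lemma coef1_line_poly f a b :
  (line_poly f a b)`_1 = \sum_(m <- msupp f) f@_m *: (line_word a b m)`_1.
Proof.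
by rewrite /line_poly coef_sum; apply: eq_bigr => m _; rewrite coefCM mulr_algl.
Qed.

(** The direction [a i * x] is radial at [x = 1]; by the Leibniz rule [x] enters each term once,
    between fixed factors. *)
Lemma generalized_linear_coef1 f a :
  generalized_linear (fun x => (line_poly f a (fun i => a i * x))`_1).
Proof.
under eq_fun do rewrite coef1_line_poly.
apply: generalized_linear_sum => m _; apply: generalized_linearZ.
elim: (m : seq nat) => [|i s IH].
  under eq_fun do rewrite /line_word big_nil coefC /=.
  exact: generalized_linear0.
under eq_fun do rewrite coef1_line_word.
apply: generalized_linearD; first exact: generalized_linear_mull.
exact: generalized_linear_mul.
Qed.

(* Euler's formula: the radial derivative weights each word by its length. *)
Lemma coef1_line_poly_radial f a :
  (line_poly f a a)`_1 =
  \sum_(m <- msupp f) (f@_m *+ size m) *: \prod_(i <- m) a i.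
Proof.
rewrite coef1_line_poly; apply: eq_bigr => m _.
rewrite -scalerMnl scalerMnr; congr (_ *: _).
elim: (m : seq nat) => [|i s IH]; first by rewrite /line_word big_nil coefC.
by rewrite coef1_line_word IH big_cons mulrnAr /= mulrSr.
Qed.

Lemma prodZ_word (t : K) a m :
  \prod_(i <- m) (t *: a i) = t ^+ size m *: \prod_(i <- m) a i.
Proof.
elim: m => [|i m IH]; first by rewrite !big_nil scale1r.
by rewrite !big_cons IH -scalerAl -scalerAr scalerA exprS.
Qed.

(** This is [f (t a)] as a polynomial in [t]. *)
Definition scaled_poly f a : {poly A} :=
  \sum_(m <- msupp f) (f@_m *: \prod_(i <- m) a i)%:P * 'X^(size m).

(* ['X * (scaled_poly f a)^`()] *)
Definition euler_poly f a : {poly A} :=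
  \sum_(m <- msupp f)
    ((f@_m *+ size m) *: \prod_(i <- m) a i)%:P * 'X^(size m).

Lemma scaled_poly1 f a : (scaled_poly f a).[1] = feval f a.
Proof.
rewrite fevalE horner_sum; apply: eq_bigr => m _.
by rewrite hornerCM hornerXn expr1n mulr1.
Qed.

Lemma euler_polyE f a (t : K) :
  (euler_poly f a).[t%:A] =
  \sum_(m <- msupp f) (f@_m *+ size m) *: \prod_(i <- m) (t *: a i).
Proof.
rewrite horner_sum; apply: eq_bigr => m _.
rewrite hornerCM hornerXn prodZ_word exprZn expr1n mulr_algr.
by rewrite !scalerA mulrC.
Qed.

Lemma coef_euler_poly f a k :
  (euler_poly f a)`_k = (scaled_poly f a)`_k *+ k.
Proof.
rewrite !coef_sum -sumrMnl; apply: eq_bigr => m _.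
rewrite !coefCM coefXn; case: eqP => [->|_]; last by rewrite !mulr0 mul0rn.
by rewrite !mulr1 scalerMnl.
Qed.

Lemma scaled_poly_coef0 f a : f@_mone = 0 -> (scaled_poly f a)`_0 = 0.
Proof.
move=> f0; rewrite coef_sum big1_seq // => m _; rewrite coefCM coefXn.
case: (eqVneq (size m) 0%N) => [/size0nil m0|_]; last by rewrite mulr0.
have -> : m = mone by apply: val_inj; rewrite /= m0 fm1.
by rewrite f0 scale0r mul0r.
Qed.

(** Each word of [f] splits at its single letter [i], giving a term [u x v]. *)
Lemma generalized_linear_subst f (i : nat) a : linear_in f i ->
  generalized_linear (fun x => feval f (fun j => if j == i then x else a j)).
Proof.
move=> lin; under eq_fun do rewrite fevalE.
apply: generalized_linear_sum => m /lin cm; apply: generalized_linearZ.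
elim: (m : seq nat) cm => [//|j s IH] /= cjs.
under eq_fun do rewrite big_cons.
have [ji|ji] := eqVneq j i; rewrite ?ji ?(negPf ji) in cjs *; last first.
  by apply: generalized_linear_mull; exact: IH.
have /eqP cs : count_mem i s == 0%N by rewrite -eqSS -[X in _ == X]cjs eqxx.
have -> : (fun x => x * \prod_(j <- s) (if j == i then x else a j)) =
    (fun x : A => 1 * x * \prod_(j <- s) a j).
  apply/funext => x; rewrite mul1r; congr (_ * _); apply: eq_big_seq => k ks.
  by case: eqP ks => // ->; rewrite -has_pred1 has_count cs.
exact: generalized_linear_mul.
Qed.

End SubstitutionPolynomials.

(** * Polynomials over [KG] in characteristic 0 *)

Section CharacteristicZero.
Context (K : fieldType) (G : groupType).
Hypothesis Kchar0 : [pchar K] =i pred0.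
Local Notation KG := (group_algebra K G).

Lemma poly_eq0_char0 (p : {poly K}) : (forall t, p.[t] = 0) -> p = 0.
Proof.
move=> p0; apply/eqP; apply: contraT => pn0.
(* In characteristic 0 these are [size p] distinct roots, one more than the degree allows. *)
pose rs : seq K := [seq n%:R | n <- iota 0 (size p)].
have : (size rs < size p)%N.
  apply: max_poly_roots => //; first by apply/allP => x _; apply/eqP.
  rewrite map_inj_in_uniq ?iota_uniq // => m n _ _.
  wlog le_mn : m n / (m <= n)%N => [W|].
    by case/orP: (leq_total m n) => [/W//|/W h /esym/h].
  move=> /eqP; rewrite eq_sym -subr_eq0 -natrB // => /eqP/eqP.
  rewrite (GRing.pcharf0P K).1 // subn_eq0 => le_nm.
  by apply/eqP; rewrite eqn_leq le_mn.
by rewrite size_map size_iota ltnn.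
Qed.

(** At a scalar [t], taking the coefficient at [z] commutes with evaluation and leaves a polynomial
    over [K]. *)
Lemma poly_mcoef_eq0 (q : {poly KG}) (z : G) :
  (forall t : K, (q.[t%:A])@_z = 0) -> forall k, (q`_k)@_z = 0.
Proof.
move=> q0 k; pose p : {poly K} := \poly_(k < size q) (q`_k)@_z.
have p0 : p = 0.
  apply: poly_eq0_char0 => t; rewrite horner_poly -[RHS](q0 t) horner_coef.
  rewrite ga_coef_sum; apply: eq_bigr => i _.
  by rewrite exprZn expr1n mulr_algr ga_coefZ mulrC.
have := coef_poly (size q) (fun k => (q`_k)@_z) k; rewrite -/p p0 coef0.
by case: ltnP => // le _; rewrite nth_default // mcoeff0.
Qed.

Lemma poly_eq0_of_values (q : {poly KG}) :
  (forall t : K, q.[t%:A] = 0) -> q = 0.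
Proof.
move=> q0; apply/polyP => k; rewrite coef0; apply/malgP => z.
by rewrite mcoeff0 poly_mcoef_eq0 // => t; rewrite q0 mcoeff0.
Qed.

End CharacteristicZero.

(** * From finite dimension to vanishing *)

Section AlmostPI.
Context (K : fieldType) (G : groupType).
Hypothesis Ginf : infinite_set [set: G].
Local Notation KG := (group_algebra K G).

(** [T] collects the supports of a finite spanning list; the elements supported in [T] form a
    subspace. *)
Lemma almost_PI_supported (f : free_algebra K) : almost_PI KG f ->
  exists T : seq G, forall a, supported_in T (feval f a : KG).
Proof.
move=> [e eE]; pose T := flatten [seq (msupp u : seq G) | u : KG <- e].
exists T => a.
have : value_space KG f (feval f a) by move=> S [_ fS]; apply: fS; exists a.
rewrite eE; apply; split=> [|u /= ue z].
  split=> [|c u v]; rewrite !inE => /=; first by move=> z _; exact: mcoeff0.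
  by move=> uT vT z zT; rewrite ga_coefD ga_coefZ uT // vT // mulr0 addr0.
apply: contraNeq; rewrite mcoeff_neq0 => zu.
by apply/flattenP; exists (msupp u : seq G) => //; apply/mapP; exists u.
Qed.

Lemma almost_PI_linear_PI (f : free_algebra K) (i : nat) :
  linear_in f i -> almost_PI KG f -> is_PI KG f.
Proof.
move=> lin /almost_PI_supported[T fT] a.
have := generalized_linear_eq0 Ginf (generalized_linear_subst a lin).
move=> /(_ T (fun x => fT _) (a i)) <-; congr feval.
by apply/funext => j; case: eqP => [->|].
Qed.

Lemma almost_PI_char0_PI (f : free_algebra K) : [pchar K] =i pred0 ->
  f@_mone = 0 -> almost_PI KG f -> is_PI KG f.
Proof.
move=> char0 f0 /almost_PI_supported[T fT].
have radial a : \sum_(m <- msupp f) (f@_m *+ size m) *: \prod_(i <- m) a i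
    = 0 :> KG.
  rewrite -coef1_line_poly_radial.
  have {2}-> : a = (fun i => a i * 1) by apply/funext => i; rewrite mulr1.
  have gl := generalized_linear_coef1 f a.
  apply: (generalized_linear_eq0 Ginf (T := T) gl _ 1) => x z zT.
  (* Outside [T] the coefficients of [f (a + t a x)] vanish for all [t], hence so does the part
     linear in [t]. *)
  apply: (poly_mcoef_eq0 char0) => t; rewrite line_polyE; exact: fT.
move=> a; rewrite -scaled_poly1.
have euler0 : euler_poly f a = 0.
  by apply: (poly_eq0_of_values char0) => t; rewrite euler_polyE radial.
suff -> : scaled_poly f a = 0 by rewrite horner0.
apply/polyP => -[|k]; rewrite coef0; first exact: scaled_poly_coef0.
(* The coefficient is killed by [k.+1], a nonzero scalar in characteristic 0. *)
have := coef_euler_poly f a k.+1; rewrite euler0 coef0 -scaler_nat => /esym.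
move=> /eqP; rewrite scaler_eq0 (GRing.pcharf0P K).1 //= => /eqP.
exact.
Qed.

End AlmostPI.

(** * Structures generated by zero values *)

Lemma smallest_set0_closed (K : fieldType) (A : algType K) (f : free_algebra K)
    (C : set A -> Prop) : is_PI A f -> C [set 0] -> (forall S, C S -> S 0) ->
  smallest C (fvalues A f) = [set 0].
Proof.
move=> PI C0 C1; apply/seteqP; split=> [u|_ -> S [CS _]]; last exact: C1.
by apply; split=> // _ [a _ <-]; exact: PI.
Qed.

Lemma is_subspace0 (K : fieldType) (V : lmodType K) : is_subspace [set (0 : V)].
Proof.
by split=> [|c u v]; rewrite !inE //= => -> ->; rewrite scaler0 addr0.
Qed.

Lemma is_subspace_zero (K : fieldType) (V : lmodType K) (S : set V) :
  is_subspace S -> S 0.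
Proof. by case; rewrite inE. Qed.

Lemma finite_dim0 (K : fieldType) (V : lmodType K) : finite_dim [set (0 : V)].
Proof.
exists [::]; apply/seteqP; split=> [_ -> S [/is_subspace_zero]//|u].
by apply; split=> [|v]; [exact: is_subspace0|].
Qed.

Theorem theorem2p9 (K : fieldType) (p : nat) (hp : has_char K p)
    (G : groupType) (hG : infinite_set [set: G])
    (f : free_algebra K) (hf0 : f@_mone = 0)
    (hf : almost_PI (group_algebra K G) f)
    (hlin : p = 0%N \/ (0 < p)%N /\ (exists i : nat, linear_in f i)) :
  is_PI (group_algebra K G) f /\
  [/\ value_space (group_algebra K G) f = [set 0],
      value_subalgebra (group_algebra K G) f = [set 0] &
      value_ideal (group_algebra K G) f = [set 0]] /\
  [/\ finite_dim (value_space (group_algebra K G) f),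
      finite_dim (value_subalgebra (group_algebra K G) f) &
      finite_dim (value_ideal (group_algebra K G) f)].
Proof.
have PI : is_PI (group_algebra K G) f.
  case: hlin => [p0|[_ [i lin]]]; last exact: almost_PI_linear_PI lin hf.
  by apply: almost_PI_char0_PI => //; move: hp; rewrite /has_char p0.
have sp0 : value_space (group_algebra K G) f = [set 0].
  apply: smallest_set0_closed PI _ (@is_subspace_zero _ _).
  exact: is_subspace0.
have alg0 : value_subalgebra (group_algebra K G) f = [set 0].
  apply: smallest_set0_closed PI _ _ => [|S [/is_subspace_zero]//].
  by split=> [|u v -> ->]; [exact: is_subspace0|rewrite /= mul0r].
have ideal0 : value_ideal (group_algebra K G) f = [set 0].
  apply: smallest_set0_closed PI _ _ => [|S [/is_subspace_zero]//].
  by split=> [|a u ->]; [exact: is_subspace0|rewrite /= mul0r mulr0].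
by rewrite sp0 alg0 ideal0; do !split=> //; exact: finite_dim0.
Qed.
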